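(* The Nagata product functor (respectively, the restricted Nagata product functor) from the category of cyclic pointed unital residuated lattice-ordered bimodules over a residuated lattice to the category of Nagata lattices (respectively, restricted Nagata lattices) is right adjoint to the structural bimodule functor. The unit of this adjunction at $\mathbf N$ is the embedding $m\mapsto\langle\sigma m,\gamma m\rangle$, and the counit is the inverse of the isomorphism $\langle e_S,e_M\rangle$ from a bimodule onto the structural bimodule of its (restricted) Nagata product.
   Context: Bimodules: $\mathbf S=\langle S,\wedge,\vee,\cdot,1,\backslash,/\rangle$ is a residuated lattice, $\mathbf M=\langle M,\wedge,\vee\rangle$ a lattice (elements of $S$ written $a,b,c$; of $M$ written $x,y,z$). A residuated lattice-ordered bimodule over $\mathbf S$ has isotone actions $a*x\in M$, $x*a\in M$ with $(a\cdot b)*x=a*(b*x)$, $x*(a\cdot b)=(x*a)*b$, $(a*x)*b=a*(x*b)$, and maps $\backslash_\ell:S\times M\to M$, $/_\ell:M\times M\to S$, $\backslash_r:M\times M\to S$, $/_r:M\times S\to M$ with $x\le a\backslash_\ell y\iff a*x\le y\iff a\le y/_\ell x$ and $x\le y/_r a\iff x*a\le y\iff a\le x\backslash_r y$. Unital: $1*x=x=x*1$. Cyclic pointed: a constant $0\in M$ with $a*0=0*a$ for all $a$. Morphisms are pairs of maps preserving all listed operations and constants (both sorts' lattice operations, multiplication, unit, residuals, actions, action residuals, $0$). Nagata product $\mathbf S\ltimes\mathbf M$: universe $S\times M$, componentwise lattice operations, $\langle a,x\rangle\circ\langle b,y\rangle=\langle a\cdot b,x*b\vee a*y\rangle$, $\langle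 a,x\rangle\backslash\langle b,y\rangle=\langle a\backslash b\wedge x\backslash_r y,a\backslash_\ell y\rangle$, $\langle a,x\rangle/\langle b,y\rangle=\langle a/b\wedge x/_\ell y,x/_r b\rangle$. The restricted Nagata product is the subalgebra on $\{\langle a,x\rangle:0*a\le x,\ a*0\le x\}$. It carries $\sigma\langle a,x\rangle=\langle a,a*0\rangle$, $\gamma\langle a,x\rangle=\langle 0\backslash_r x,x\rangle$, constants $1:=\langle 1,0\rangle$ (in the unrestricted case $\langle 1,1*0\rangle$, which is the same) and $0:=e_M(0)$, where $e_S(a)=\langle a,a*0\rangle$, $e_M(x)=\langle 0\backslash_r x,x\rangle$. For an idempotent isotone $\gamma$ write $N_\gamma=\gamma[N]$. A pre-conucleus on a semigroup is an idempotent isotone $\sigma$ with $N_\sigma$ a subsemigroup; a $\sigma$-closure operator is an idempotent isotone $\gamma$ with $a\cdot x\le\gamma(a\cdot x)$, $x\cdot a\le\gamma(x\cdot a)$ ($a\in N_\sigma$, $x\in N_\gamma$); it is $\sigma$-structural if $a\cdot\gamma m\le\gamma(a\cdot m)$, $\gamma m\cdot a\le\gamma(m\cdot a)$ for $a\in N_\sigma$, $m\in N$. A Nagata lattice is a residuated $\ell$-semigroup $\mathbf N$ (lattice with residuated multiplication) with a pre-conucleus $\sigma$, a $\sigma$-structural $\sigma$-closure operator $\gamma$, constants $1\in N_\sigma$, $0\in N_\gamma$, satisfying: $\sigma(xy)=\sigma x\sigma y$; $\gamma(xy)=\sigma x\gamma y\vee\gamma x\sigma y$; $\sigma(x\wedge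 y)=\sigma(\sigma x\wedge\sigma y)$; $\gamma(x\vee y)=\gamma(\gamma x\vee\gamma y)$; $\sigma(x\vee y)=\sigma x\vee\sigma y$; $\gamma(x\wedge y)=\gamma x\wedge\gamma y$; $\sigma(x\backslash y)=\sigma(\sigma x\backslash\sigma y\wedge\gamma x\backslash\gamma y)$; $\sigma(y/x)=\sigma(\sigma y/\sigma x\wedge\gamma y/\gamma x)$; $\sigma x\backslash\gamma y=\gamma(x\backslash y)$; $\gamma y/\sigma x=\gamma(y/x)$; $\sigma\gamma x=\sigma(0\backslash\gamma x)=\sigma(\gamma x/0)$; $\gamma\sigma x=\gamma(0\cdot\sigma x)=\gamma(\sigma x\cdot 0)$; $1\le\sigma(x\backslash x)$; $1\le\sigma(x/x)$; and the quasi-equations $1\le\sigma(x\backslash y)\Rightarrow x\le y$, $1\le\sigma(y/x)\Rightarrow x\le y$. A restricted Nagata lattice is a residuated lattice $\mathbf N$ (with unit $1$) with a unital conucleus $\sigma$ (interior operator with $\sigma x\sigma y\le\sigma(xy)$, $\sigma 1=1$), a $\sigma$-structural closure operator $\gamma$, and a constant $0\in N_\gamma$, satisfying $\sigma(xy)=\sigma x\sigma y$; $xy=\sigma x\cdot y\vee x\cdot\sigma y$; $\sigma x\backslash y\wedge x\backslash\gamma y=x\backslash y$; $x/\sigma y\wedge\gamma x/y=x/y$; $\sigma x\backslash\gamma y=\gamma(x\backslash y)$; $\gamma y/\sigma x=\gamma(y/x)$; $\sigma\gamma x=\sigma(0\backslash\gamma x)=\sigma(\gamma x/0)$; $\gamma\sigma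 x=\gamma(0\cdot\sigma x)=\gamma(\sigma x\cdot 0)$. Morphisms of (restricted) Nagata lattices preserve all operations, $\sigma,\gamma$ and constants. The structural bimodule functor sends $\mathbf N$ to the bimodule with scalars $N_\sigma$ (multiplication and join inherited, meet $\sigma(a\wedge b)$, residuals $\sigma(a\backslash b),\sigma(a/b)$, unit $1$, resp. $\sigma 1$), module $N_\gamma$ (meet inherited, join $\gamma(x\vee y)$), actions $a*x=\gamma(a\cdot x)$, $x*a=\gamma(x\cdot a)$, residuals $x\backslash_r y=\sigma(x\backslash y)$, $a\backslash_\ell x=\gamma(a\backslash x)$, $y/_\ell x=\sigma(y/x)$, $x/_r a=\gamma(x/a)$, point $0$; morphisms are sent to their restrictions.
   Formalization: The Nagata lattice law for γ(xy) is taken as γ(xy)=γ(σxγy∨γxσy), since the literal one fails in Nagata products; restricted Nagata lattices are also required to satisfy σ(x∨y)=σx∨σy and γ(x∧y)=γx∧γy, without which the unit is not a morphism. *)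

(* Defs.v *)
From HB Require Import structures.
From mathcomp Require Import all_boot all_order.
From mathcomp Require Import boolp classical_sets.

Set Implicit Arguments.
Unset Strict Implicit.
Unset Printing Implicit Defensive.

Import Order.TTheory.
Local Open Scope order_scope.

(* Displays only steer the printing of order notations, so one of them is    *)
(* fixed for all lattices.                                                   *)
Notation disp := (Order.Disp tt tt).
Notation lattice := (latticeType disp).

Record category := Category {
  Ob :> Type;
  Hom : Ob -> Ob -> Type;
  idm : forall X, Hom X X;
  comp : forall X Y Z, Hom Y Z -> Hom X Y -> Hom X Z;
  comp_idl : forall X Y (f : Hom X Y), comp (idm Y) f = f;
  comp_idr : forall X Y (f : Hom X Y), comp f (idm X) = f;
  compA : forall X Y Z W (h : Hom Z W) (g : Hom Y Z) (f : Hom X Y),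
    comp h (comp g f) = comp (comp h g) f }.
Arguments idm {c} X.
Arguments comp {c X Y Z} _ _.

Record functor (C D : category) := Functor {
  fob :> C -> D;
  fmap : forall X Y : C, Hom X Y -> Hom (fob X) (fob Y);
  fmap_id : forall X, fmap (idm X) = idm (fob X);
  fmap_comp : forall X Y Z (g : Hom Y Z) (f : Hom X Y),
    fmap (comp g f) = comp (fmap g) (fmap f) }.
Arguments fmap {C D} f0 {X Y} _.

(* [adjunction F G]: the functor [G] is right adjoint to [F].                *)
Record adjunction (C D : category) (F : functor C D) (G : functor D C) :=
  Adjunction {
  unit_adj : forall X : C, Hom X (G (F X));
  counit_adj : forall Y : D, Hom (F (G Y)) Y;
  unit_nat : forall (X X' : C) (f : Hom X X'),
    comp (unit_adj X') f = comp (fmap G (fmap F f)) (unit_adj X);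
  counit_nat : forall (Y Y' : D) (g : Hom Y Y'),
    comp (counit_adj Y') (fmap F (fmap G g)) = comp g (counit_adj Y);
  triangleF : forall X : C,
    comp (counit_adj (F X)) (fmap F (unit_adj X)) = idm (F X);
  triangleG : forall Y : D,
    comp (fmap G (counit_adj Y)) (unit_adj (G Y)) = idm (G Y) }.

(* [ldiv x z] is x \ z and [rdiv z y] is z / y.                              *)
Record resLSemigroup := ResLSemigroup {
  rs_sort :> lattice;
  mul : rs_sort -> rs_sort -> rs_sort;
  ldiv : rs_sort -> rs_sort -> rs_sort;
  rdiv : rs_sort -> rs_sort -> rs_sort;
  mulA : associative mul;
  ldivE : forall x y z, (y <= ldiv x z) = (mul x y <= z);
  rdivE : forall x y z, (x <= rdiv z y) = (mul x y <= z) }.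
Arguments mul {r} _ _.
Arguments ldiv {r} _ _.
Arguments rdiv {r} _ _.
Notation "x ** y" := (mul x y) (at level 40, left associativity).

Record resLattice := ResLattice {
  rl_sort :> resLSemigroup;
  rl1 : rl_sort;
  rl_mul1x : left_id rl1 (@mul rl_sort);
  rl_mulx1 : right_id rl1 (@mul rl_sort) }.
Arguments rl1 {r}.

Record resLSemigroup_morph (N N' : resLSemigroup) (f : N -> N') : Prop :=
  ResLSemigroupMorph {
  morph_meet : {morph f : x y / x `&` y};
  morph_join : {morph f : x y / x `|` y};
  morph_mul : {morph f : x y / x ** y};
  morph_ldiv : {morph f : x y / ldiv x y};
  morph_rdiv : {morph f : x y / rdiv x y} }.

(* Cyclic pointed unital residuated lattice-ordered bimodules:               *)
(*   a *> x    = a * x        x <* a    = x * a                              *)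
(*   mdl a y   = a \_l y      sdl y x   = y /_l x                            *)
(*   sdr x y   = x \_r y      mdr y a   = y /_r a                            *)
Record bimodule := Bimodule {
  scal : resLattice;
  modl : lattice;
  lact : scal -> modl -> modl;
  ract : modl -> scal -> modl;
  mdl : scal -> modl -> modl;
  sdl : modl -> modl -> scal;
  sdr : modl -> modl -> scal;
  mdr : modl -> scal -> modl;
  pt : modl;
  lact_homo : forall a b x y, a <= b -> x <= y -> lact a x <= lact b y;
  ract_homo : forall a b x y, a <= b -> x <= y -> ract x a <= ract y b;
  lactA : forall a b x, lact (a ** b) x = lact a (lact b x);
  ractA : forall a b x, ract x (a ** b) = ract (ract x a) b;
  lractA : forall a b x, ract (lact a x) b = lact a (ract x b);
  mdlE : forall a x y, (x <= mdl a y) = (lact a x <= y);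
  sdlE : forall a x y, (a <= sdl y x) = (lact a x <= y);
  mdrE : forall a x y, (x <= mdr y a) = (ract x a <= y);
  sdrE : forall a x y, (a <= sdr x y) = (ract x a <= y);
  lact1 : forall x, lact rl1 x = x;
  ract1 : forall x, ract x rl1 = x;
  pt_cyclic : forall a, lact a pt = ract pt a }.
Arguments lact {_} _ _.
Arguments ract {_} _ _.
Arguments mdl {_} _ _.
Arguments sdl {_} _ _.
Arguments sdr {_} _ _.
Arguments mdr {_} _ _.
Arguments pt {_}.
Notation "a *> x" := (lact a x) (at level 40, left associativity).
Notation "x <* a" := (ract x a) (at level 40, left associativity).

Record bimodule_morph (B B' : bimodule)
    (f : scal B -> scal B') (g : modl B -> modl B') : Prop := BimoduleMorph {
  bm_scal : resLSemigroup_morph f;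
  bm_one : f rl1 = rl1;
  bm_meet : {morph g : x y / x `&` y};
  bm_join : {morph g : x y / x `|` y};
  bm_lact : forall a x, g (a *> x) = f a *> g x;
  bm_ract : forall x a, g (x <* a) = g x <* f a;
  bm_mdl : forall a y, g (mdl a y) = mdl (f a) (g y);
  bm_sdl : forall y x, f (sdl y x) = sdl (g y) (g x);
  bm_sdr : forall x y, f (sdr x y) = sdr (g x) (g y);
  bm_mdr : forall y a, g (mdr y a) = mdr (g y) (f a);
  bm_pt : g pt = pt }.

Record bimodule_hom (B B' : bimodule) := BimoduleHom {
  hscal : scal B -> scal B';
  hmodl : modl B -> modl B';
  bimodule_homP : bimodule_morph hscal hmodl }.

Record nagataOps := NagataOps {
  no_sort :> resLSemigroup;
  sigma : no_sort -> no_sort;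
  gamma : no_sort -> no_sort;
  nl1 : no_sort;
  nl0 : no_sort }.
Arguments sigma {n} _.
Arguments gamma {n} _.
Arguments nl1 {n}.
Arguments nl0 {n}.

Record nagata_morph (N N' : nagataOps) (f : N -> N') : Prop := NagataMorph {
  nm_res : resLSemigroup_morph f;
  nm_sigma : {morph f : x / sigma x};
  nm_gamma : {morph f : x / gamma x};
  nm_one : f nl1 = nl1;
  nm_zero : f nl0 = nl0 }.

Record nagata_hom (N N' : nagataOps) := NagataHom {
  nagata_fun :> N -> N';
  nagata_homP : nagata_morph nagata_fun }.

Section Predicates.
Variable N : resLSemigroup.
Implicit Types s g : N -> N.

(* N_s, the image of s, is written [range s].                                *)
Record pre_conucleus s : Prop := PreConucleus {
  pc_idem : idempotent_fun s;
  pc_homo : {homo s : x y / x <= y};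
  pc_mul : forall a b, range s a -> range s b -> range s (a ** b) }.

(* Extensivity is only required of the products a ** x and x ** a.           *)
Record sclosure_operator s g : Prop := SClosureOperator {
  sc_idem : idempotent_fun g;
  sc_homo : {homo g : x y / x <= y};
  sc_l : forall a x, range s a -> range g x -> a ** x <= g (a ** x);
  sc_r : forall a x, range s a -> range g x -> x ** a <= g (x ** a) }.

Record structural s g : Prop := Structural {
  str_l : forall a m, range s a -> a ** g m <= g (a ** m);
  str_r : forall a m, range s a -> g m ** a <= g (m ** a) }.

Record conucleus s : Prop := Conucleus {
  cn_le : forall x, s x <= x;
  cn_idem : idempotent_fun s;
  cn_homo : {homo s : x y / x <= y};
  cn_mul : forall x y, s x ** s y <= s (x ** y) }.

Record closure_operator g : Prop := ClosureOperator {
  cl_ge : forall x, x <= g x;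
  cl_idem : idempotent_fun g;
  cl_homo : {homo g : x y / x <= y} }.

End Predicates.

Record is_nagata (N : nagataOps) : Prop := IsNagata {
  nl_sigma : pre_conucleus (@sigma N);
  nl_gamma : sclosure_operator (@sigma N) (@gamma N);
  nl_str : structural (@sigma N) (@gamma N);
  nl_one : range (@sigma N) nl1;
  nl_zero : range (@gamma N) nl0;
  nl_sM : forall x y : N, sigma (x ** y) = sigma x ** sigma y;
  (* The outer gamma on the right cannot be dropped: N_gamma carries the     *)
  (* join gamma (u `|` v), and in the Nagata product of the two-element      *)
  (* Boolean algebra with a trivial module gamma is constantly the top, so   *)
  (* that the right-hand side without gamma is bottom for x = y = bottom.    *)
  nl_gM : forall x y : N,
    gamma (x ** y) = gamma (sigma x ** gamma y `|` gamma x ** sigma y);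
  nl_sI : forall x y : N, sigma (x `&` y) = sigma (sigma x `&` sigma y);
  nl_gU : forall x y : N, gamma (x `|` y) = gamma (gamma x `|` gamma y);
  nl_sU : forall x y : N, sigma (x `|` y) = sigma x `|` sigma y;
  nl_gI : forall x y : N, gamma (x `&` y) = gamma x `&` gamma y;
  nl_sl : forall x y : N,
    sigma (ldiv x y)
      = sigma (ldiv (sigma x) (sigma y) `&` ldiv (gamma x) (gamma y));
  nl_sr : forall x y : N,
    sigma (rdiv y x)
      = sigma (rdiv (sigma y) (sigma x) `&` rdiv (gamma y) (gamma x));
  nl_gl : forall x y : N, ldiv (sigma x) (gamma y) = gamma (ldiv x y);
  nl_gr : forall x y : N, rdiv (gamma y) (sigma x) = gamma (rdiv y x);
  nl_sgl : forall x : N, sigma (gamma x) = sigma (ldiv nl0 (gamma x));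
  nl_sgr : forall x : N, sigma (gamma x) = sigma (rdiv (gamma x) nl0);
  nl_gsl : forall x : N, gamma (sigma x) = gamma (nl0 ** sigma x);
  nl_gsr : forall x : N, gamma (sigma x) = gamma (sigma x ** nl0);
  nl_1l : forall x : N, nl1 <= sigma (ldiv x x);
  nl_1r : forall x : N, nl1 <= sigma (rdiv x x);
  nl_lel : forall x y : N, nl1 <= sigma (ldiv x y) -> x <= y;
  nl_ler : forall x y : N, nl1 <= sigma (rdiv y x) -> x <= y }.

Record is_rnagata (N : nagataOps) : Prop := IsRNagata {
  rn_mul1x : left_id nl1 (@mul N);
  rn_mulx1 : right_id nl1 (@mul N);
  rn_sigma : conucleus (@sigma N);
  rn_s1 : sigma (@nl1 N) = nl1;
  rn_gamma : closure_operator (@gamma N);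
  rn_str : structural (@sigma N) (@gamma N);
  rn_zero : range (@gamma N) nl0;
  rn_sM : forall x y : N, sigma (x ** y) = sigma x ** sigma y;
  rn_M : forall x y : N, x ** y = sigma x ** y `|` x ** sigma y;
  rn_l : forall x y : N, ldiv (sigma x) y `&` ldiv x (gamma y) = ldiv x y;
  rn_r : forall x y : N, rdiv x (sigma y) `&` rdiv (gamma x) y = rdiv x y;
  rn_gl : forall x y : N, ldiv (sigma x) (gamma y) = gamma (ldiv x y);
  rn_gr : forall x y : N, rdiv (gamma y) (sigma x) = gamma (rdiv y x);
  rn_sgl : forall x : N, sigma (gamma x) = sigma (ldiv nl0 (gamma x));
  rn_sgr : forall x : N, sigma (gamma x) = sigma (rdiv (gamma x) nl0);
  rn_gsl : forall x : N, gamma (sigma x) = gamma (nl0 ** sigma x);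
  rn_gsr : forall x : N, gamma (sigma x) = gamma (sigma x ** nl0);
  (* The last two laws, shared with Nagata lattices, make                    *)
  (* m |-> (sigma m, gamma m) preserve joins and meets. Neither follows from *)
  (* the other laws. For rn_gI: on the lattice {0, 1, p, t} with 0 < 1, p    *)
  (* and 1, p < t, let x ** y be the minimum in the chain 0 < p < t < 1,     *)
  (* sigma the identity, gamma p = t and gamma x = x otherwise, nl0 = 1;     *)
  (* then gamma (1 `&` p) = 0 but gamma 1 `&` gamma p = 1.                   *)
  rn_sU : forall x y : N, sigma (x `|` y) = sigma x `|` sigma y;
  rn_gI : forall x y : N, gamma (x `&` y) = gamma x `&` gamma y }.

Record nagataLattice := NagataLattice {
  nl_ops :> nagataOps;
  nlP : is_nagata nl_ops }.

Record rnagataLattice := RNagataLattice {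
  rn_ops :> nagataOps;
  rnP : is_rnagata rn_ops }.

Section Categories.

Lemma res_morph_id (N : resLSemigroup) : resLSemigroup_morph (@id N).
Proof. by []. Qed.

Lemma res_morph_comp (N1 N2 N3 : resLSemigroup) (g : N2 -> N3) (f : N1 -> N2) :
  resLSemigroup_morph g -> resLSemigroup_morph f ->
  resLSemigroup_morph (g \o f).
Proof.
by case=> g1 g2 g3 g4 g5 [f1 f2 f3 f4 f5]; split=> x y /=;
  rewrite ?(f1, f2, f3, f4, f5) ?(g1, g2, g3, g4, g5).
Qed.

Lemma bimodule_hom_eq (B B' : bimodule) (h k : bimodule_hom B B') :
  hscal h =1 hscal k -> hmodl h =1 hmodl k -> h = k.
Proof.
case: h k => [f g p] [f' g' p'] /= /funext ff /funext gg.
by case: _ / ff p' => p'; case: _ / gg p' => p'; rewrite (Prop_irrelevance p p').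
Qed.

Definition bimodule_id (B : bimodule) : bimodule_hom B B.
Proof. by apply: (@BimoduleHom _ _ id id); split=> //; apply: res_morph_id. Defined.

Definition bimodule_comp (B1 B2 B3 : bimodule)
  (g : bimodule_hom B2 B3) (f : bimodule_hom B1 B2) : bimodule_hom B1 B3.
Proof.
apply: (@BimoduleHom _ _ (hscal g \o hscal f) (hmodl g \o hmodl f)).
case: g f => [gs gm [g0 g1 g2 g3 g4 g5 g6 g7 g8 g9 g10]].
case=> [fs fm [f0 f1 f2 f3 f4 f5 f6 f7 f8 f9 f10]] /=.
split; first (by apply: res_morph_comp); repeat (move=> ? /=);
by rewrite /= ?(f1, f2, f3, f4, f5, f6, f7, f8, f9, f10)
  ?(g1, g2, g3, g4, g5, g6, g7, g8, g9, g10).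
Defined.

Definition bimodule_cat : category.
Proof.
by apply: (@Category bimodule bimodule_hom bimodule_id bimodule_comp) => *;
  apply: bimodule_hom_eq.
Defined.

Lemma nagata_hom_eq (N N' : nagataOps) (h k : nagata_hom N N') :
  h =1 k -> h = k.
Proof.
case: h k => [f p] [f' p'] /= /funext ff.
by case: _ / ff p' => p'; rewrite (Prop_irrelevance p p').
Qed.

Definition nagata_id (N : nagataOps) : nagata_hom N N.
Proof. by apply: (@NagataHom _ _ id); split=> //; apply: res_morph_id. Defined.

Definition nagata_comp (N1 N2 N3 : nagataOps)
  (g : nagata_hom N2 N3) (f : nagata_hom N1 N2) : nagata_hom N1 N3.
Proof.
apply: (@NagataHom _ _ (g \o f)).
case: g f => [g [g0 g1 g2 g3 g4]] [f [f0 f1 f2 f3 f4]] /=.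
split; first (by apply: res_morph_comp); repeat (move=> ? /=);
by rewrite /= ?(f1, f2, f3, f4) ?(g1, g2, g3, g4).
Defined.

Definition nagata_cat : category.
Proof.
by apply: (@Category nagataLattice nagata_hom nagata_id nagata_comp) => *;
  apply: nagata_hom_eq.
Defined.

Definition rnagata_cat : category.
Proof.
by apply: (@Category rnagataLattice nagata_hom nagata_id nagata_comp) => *;
  apply: nagata_hom_eq.
Defined.

End Categories.

Section NagataProduct.
Variable B : bimodule.
Implicit Types (a b c : scal B) (x y z : modl B).

Lemma lact_joinr a x y : a *> (x `|` y) = a *> x `|` a *> y.
Proof.
apply/le_anti/andP; split; first by rewrite -mdlE leUx !mdlE leUl leUr.
by rewrite leUx !lact_homo // ?leUl ?leUr.
Qed.

Lemma lact_joinl a b x : (a `|` b) *> x = a *> x `|` b *> x.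
Proof.
apply/le_anti/andP; split; first by rewrite -sdlE leUx !sdlE leUl leUr.
by rewrite leUx !lact_homo // ?leUl ?leUr.
Qed.

Lemma ract_joinl a x y : (x `|` y) <* a = x <* a `|` y <* a.
Proof.
apply/le_anti/andP; split; first by rewrite -mdrE leUx !mdrE leUl leUr.
by rewrite leUx !ract_homo // ?leUl ?leUr.
Qed.

Lemma ract_joinr a b x : x <* (a `|` b) = x <* a `|` x <* b.
Proof.
apply/le_anti/andP; split; first by rewrite -sdrE leUx !sdrE leUl leUr.
by rewrite leUx !ract_homo // ?leUl ?leUr.
Qed.

Definition nagata_car := scal B *prod[disp] modl B.
Implicit Types p q r : nagata_car.

Definition nagata_mul p q : nagata_car :=
  (p.1 ** q.1, p.2 <* q.1 `|` p.1 *> q.2).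
Definition nagata_ldiv p q : nagata_car :=
  (ldiv p.1 q.1 `&` sdr p.2 q.2, mdl p.1 q.2).
Definition nagata_rdiv p q : nagata_car :=
  (rdiv p.1 q.1 `&` sdl p.2 q.2, mdr p.2 q.1).

Lemma nagata_mulA : associative nagata_mul.
Proof.
move=> [a x] [b y] [c z]; congr pair => /=; first by rewrite mulA.
by rewrite ract_joinl lact_joinr ractA lactA lractA joinA.
Qed.

Lemma nagata_ldivE p q r : (q <= nagata_ldiv p r) = (nagata_mul p q <= r).
Proof. by rewrite !leEprod /= lexI leUx ldivE sdrE mdlE andbA. Qed.

Lemma nagata_rdivE p q r : (p <= nagata_rdiv r q) = (nagata_mul p q <= r).
Proof.
by rewrite !leEprod /= lexI leUx rdivE sdlE mdrE -!andbA (andbC (_ *> _ <= _)).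
Qed.

Definition nagata_res : resLSemigroup :=
  ResLSemigroup nagata_mulA nagata_ldivE nagata_rdivE.

Definition e_S a : nagata_res := (a, a *> pt).
Definition e_M x : nagata_res := (sdr pt x, x).

Definition nagata_ops : nagataOps :=
  @NagataOps nagata_res (fun p => e_S p.1) (fun p => e_M p.2)
    (rl1, pt) (e_M pt).

End NagataProduct.

Section ResiduationFacts.
Variable N : resLSemigroup.
Implicit Types x y z : N.

Lemma mul_ldiv x y : x ** ldiv x y <= y.
Proof. by rewrite -ldivE. Qed.

Lemma mul_rdiv x y : rdiv y x ** x <= y.
Proof. by rewrite -rdivE. Qed.

Lemma mul_homo x y x' y' : x <= x' -> y <= y' -> x ** y <= x' ** y'.
Proof.
move=> xx' yy'; rewrite -ldivE (le_trans yy') // ldivE -rdivE.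
by rewrite (le_trans xx') // rdivE.
Qed.

Lemma mul_joinl x y z : (x `|` y) ** z = x ** z `|` y ** z.
Proof.
apply/le_anti/andP; split; first by rewrite -rdivE leUx !rdivE leUl leUr.
by rewrite leUx !mul_homo // ?leUl ?leUr.
Qed.

Lemma mul_joinr x y z : z ** (x `|` y) = z ** x `|` z ** y.
Proof.
apply/le_anti/andP; split; first by rewrite -ldivE leUx !ldivE leUl leUr.
by rewrite leUx !mul_homo // ?leUl ?leUr.
Qed.

Lemma ldiv_homo x x' y y' : x' <= x -> y <= y' -> ldiv x y <= ldiv x' y'.
Proof.
move=> xx' yy'; rewrite ldivE (le_trans _ yy') // (le_trans _ (mul_ldiv x y)) //.
exact: mul_homo.
Qed.

Lemma rdiv_homo x x' y y' : x' <= x -> y <= y' -> rdiv y x <= rdiv y' x'.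
Proof.
move=> xx' yy'; rewrite rdivE (le_trans _ yy') // (le_trans _ (mul_rdiv x y)) //.
exact: mul_homo.
Qed.

End ResiduationFacts.

Lemma rangeE (T : Type) (f : T -> T) (x : T) :
  idempotent_fun f -> range f x -> f x = x.
Proof. by move=> ff [y _ <-]; exact: ff. Qed.

Lemma rangeI (T : Type) (f : T -> T) (x : T) : range f (f x).
Proof. by exists x. Qed.

Lemma le_eqP (L : lattice) (x y : L) : (forall z, (z <= x) = (z <= y)) -> x = y.
Proof. by move=> xy; apply/le_anti; rewrite -xy lexx xy lexx. Qed.

Section NagataProductP.
Variable B : bimodule.
Implicit Types (a b c : scal B) (x y z : modl B).

Lemma lact_sdl x y : sdl y x *> x <= y. Proof. by rewrite -sdlE. Qed.
Lemma ract_sdr x y : x <* sdr x y <= y. Proof. by rewrite -sdrE. Qed.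
Lemma lact_mdl a y : a *> mdl a y <= y. Proof. by rewrite -mdlE. Qed.
Lemma ract_mdr a y : mdr y a <* a <= y. Proof. by rewrite -mdrE. Qed.

Lemma sdr_homo x y z : y <= z -> sdr x y <= sdr x z.
Proof. by move=> yz; rewrite sdrE (le_trans _ yz) // ract_sdr. Qed.

Lemma sdrI x y z : sdr x (y `&` z) = sdr x y `&` sdr x z.
Proof. by apply: le_eqP => a; rewrite sdrE !lexI !sdrE. Qed.

Lemma pt_sdr_mdl a y : sdr pt (mdl a y) = ldiv a (sdr pt y).
Proof. by apply: le_eqP => c; rewrite sdrE mdlE ldivE sdrE -pt_cyclic -lactA pt_cyclic. Qed.

Lemma pt_sdr_mdr a y : sdr pt (mdr y a) = rdiv (sdr pt y) a.
Proof. by apply: le_eqP => c; rewrite sdrE mdrE rdivE sdrE ractA. Qed.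

Lemma pt_lact a b : (a *> pt) <* b = (a ** b) *> pt.
Proof. by rewrite lractA -pt_cyclic lactA. Qed.

Lemma lact_ptE a y : (a *> pt <= y) = (a <= sdr pt y).
Proof. by rewrite pt_cyclic sdrE. Qed.

(* Facts shared by the Nagata product and the restricted Nagata product.     *)
Lemma nagata_sM (p q : nagata_ops B) : sigma (p ** q) = sigma p ** sigma q.
Proof.
congr pair => /=; apply/esym.
by rewrite pt_lact -lactA joinxx.
Qed.

Lemma nagata_structural : structural (@sigma (nagata_ops B)) (@gamma (nagata_ops B)).
Proof.
split=> [] _ [b y] [[a x] _ <-]; rewrite leEprod /=; apply/andP; split.
- rewrite -lact_ptE lactA (le_trans _ (leUr _ _)) // lact_homo //.
  by rewrite pt_cyclic ract_sdr.
- rewrite leUx leUr andbT (le_trans _ (leUr _ _)) // lractA lact_homo //.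
  exact: ract_sdr.
- rewrite -lact_ptE -pt_lact (le_trans _ (leUl _ _)) // ract_homo //.
  by rewrite pt_cyclic ract_sdr.
- rewrite leUx leUl /= (le_trans _ (leUl _ _)) // pt_cyclic -lractA.
  by rewrite ract_homo // pt_cyclic ract_sdr.
Qed.

Lemma nagata_gl (p q : nagata_ops B) : ldiv (sigma p) (gamma q) = gamma (ldiv p q).
Proof.
case: p q => a x [b y]; congr pair => /=.
apply: le_eqP => c; rewrite lexI pt_sdr_mdl.
case: (boolP (c <= ldiv a _)) => //=; rewrite ldivE -lact_ptE sdrE pt_lact.
by move=> ->.
Qed.

Lemma nagata_gr (p q : nagata_ops B) : rdiv (gamma q) (sigma p) = gamma (rdiv q p).
Proof.
case: p q => a x [b y]; congr pair => /=.
apply: le_eqP => c; rewrite lexI pt_sdr_mdr.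
case: (boolP (c <= rdiv _ a)) => //=; rewrite rdivE -lact_ptE sdlE -lactA.
by move=> ->.
Qed.

Lemma sdl_pt x : sdl x pt = sdr pt x.
Proof. by apply: le_eqP => c; rewrite sdlE lact_ptE. Qed.

Lemma nagata_sgl (p : nagata_ops B) : sigma (gamma p) = sigma (ldiv nl0 (gamma p)).
Proof.
case: p => a x; congr e_S => /=; apply/esym/meet_idPr.
rewrite ldivE sdrE ractA (le_trans _ (ract_sdr pt x)) // ract_homo //.
exact: ract_sdr.
Qed.

Lemma nagata_sgr (p : nagata_ops B) : sigma (gamma p) = sigma (rdiv (gamma p) nl0).
Proof.
case: p => a x; congr e_S => /=; rewrite sdl_pt; apply/esym/meet_idPr.
rewrite rdivE -lact_ptE lactA (@le_trans _ _ (sdr pt x *> pt)) //.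
  by rewrite lact_homo // pt_cyclic ract_sdr.
by rewrite pt_cyclic ract_sdr.
Qed.

Lemma nagata_gsl (p : nagata_ops B) : gamma (sigma p) = gamma (nl0 ** sigma p).
Proof.
case: p => a x; congr e_M => /=; rewrite [X in X `|` _]/= -pt_cyclic.
apply/esym/join_idPl; rewrite pt_cyclic -lractA ract_homo //.
by rewrite pt_cyclic ract_sdr.
Qed.

Lemma nagata_gsr (p : nagata_ops B) : gamma (sigma p) = gamma (sigma p ** nl0).
Proof.
case: p => a x; congr e_M => /=; apply/esym/join_idPr.
by rewrite lractA lact_homo // ract_sdr.
Qed.

Lemma nagata_gI (p q : nagata_ops B) : gamma (p `&` q) = gamma p `&` gamma q.
Proof. by congr pair; rewrite /= sdrI. Qed.

Lemma nagata_sU (p q : nagata_ops B) : sigma (p `|` q) = sigma p `|` sigma q.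
Proof. by congr pair; rewrite /= lact_joinl. Qed.

Lemma nagata_s_homo : {homo @sigma (nagata_ops B) : p q / p <= q}.
Proof.
by move=> [a x] [b y]; rewrite !leEprod /= => /andP[ab _]; rewrite ab lact_homo.
Qed.

Lemma nagata_g_homo : {homo @gamma (nagata_ops B) : p q / p <= q}.
Proof.
by move=> [a x] [b y]; rewrite !leEprod /= => /andP[_ xy]; rewrite xy sdr_homo.
Qed.

Lemma nagata_sl (p q : nagata_ops B) : sigma (ldiv p q)
  = sigma (ldiv (sigma p) (sigma q) `&` ldiv (gamma p) (gamma q)).
Proof.
case: p q => [a x] [b y]; congr e_S; rewrite /= /sigma /=.
apply: le_eqP => c; rewrite !lexI.
case ca: (c <= ldiv a b) => /=; last by [].
have -> /= : c <= sdr (a *> pt) (b *> pt).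
  by rewrite sdrE pt_lact lact_homo // -ldivE.
case cx: (c <= sdr x y); last by rewrite andbF.
apply/esym; rewrite andbT ldivE sdrE ractA.
rewrite sdrE in cx; rewrite (le_trans _ cx) // ract_homo //; exact: ract_sdr.
Qed.

Lemma nagata_sr (p q : nagata_ops B) : sigma (rdiv q p)
  = sigma (rdiv (sigma q) (sigma p) `&` rdiv (gamma q) (gamma p)).
Proof.
case: p q => [a x] [b y]; congr e_S; rewrite /= /sigma /=.
apply: le_eqP => c; rewrite !lexI.
case ca: (c <= rdiv b a) => /=; last by [].
have -> /= : c <= sdl (b *> pt) (a *> pt).
  by rewrite sdlE -lactA lact_homo // -rdivE.
case cx: (c <= sdl y x); last by rewrite andbF.
apply/esym; rewrite andbT rdivE -lact_ptE lactA.
rewrite sdlE in cx; rewrite (le_trans _ cx) // lact_homo //.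
by rewrite pt_cyclic; exact: ract_sdr.
Qed.

Lemma nagataP : is_nagata (nagata_ops B).
Proof.
split.
- split; [by [] | exact: nagata_s_homo | ].
  move=> _ _ [p _ <-] [q _ <-]; rewrite -nagata_sM; exact: rangeI.
- split; [by [] | exact: nagata_g_homo | |].
  + move=> _ _ [[a x] _ <-] [[b y] _ <-]; rewrite leEprod /= lexx andbT.
    rewrite -lact_ptE lactA (le_trans _ (leUr _ _)) // lact_homo //.
    by rewrite pt_cyclic ract_sdr.
  + move=> _ _ [[a x] _ <-] [[b y] _ <-]; rewrite leEprod /= lexx andbT.
    rewrite -lact_ptE -pt_lact (le_trans _ (leUl _ _)) // ract_homo //.
    by rewrite pt_cyclic ract_sdr.
- exact: nagata_structural.
- exists (rl1, pt); rewrite //= /e_S /=; by rewrite lact1.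
- by exists (rl1, pt).
- exact: nagata_sM.
- move=> [a x] [b y]; congr e_M => /=.
  have h1 : (a *> pt) <* sdr pt y <= a *> y.
    by rewrite lractA lact_homo // ract_sdr.
  have h2 : sdr pt x *> (b *> pt) <= x <* b.
    by rewrite pt_cyclic -lractA ract_homo // pt_cyclic ract_sdr.
  by rewrite (join_r h1) (join_l h2) joinC.
- by move=> [a x] [b y].
- by move=> [a x] [b y].
- exact: nagata_sU.
- exact: nagata_gI.
- exact: nagata_sl.
- exact: nagata_sr.
- exact: nagata_gl.
- exact: nagata_gr.
- exact: nagata_sgl.
- exact: nagata_sgr.
- exact: nagata_gsl.
- exact: nagata_gsr.
- move=> [a x]; rewrite leEprod /=.
  have h : rl1 <= ldiv a a `&` sdr x x by rewrite lexI ldivE rl_mulx1 sdrE ract1 !lexx.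
  by rewrite h -[leLHS]lact1 lact_homo.
- move=> [a x]; rewrite leEprod /=.
  have h : rl1 <= rdiv a a `&` sdl x x by rewrite lexI rdivE rl_mul1x sdlE lact1 !lexx.
  by rewrite h -[leLHS]lact1 lact_homo.
- move=> [a x] [b y]; rewrite leEprod /= lexI => /andP[/andP[+ +] _].
  by rewrite ldivE rl_mulx1 sdrE ract1 leEprod /= => -> ->.
- move=> [a x] [b y]; rewrite leEprod /= lexI => /andP[/andP[+ +] _].
  by rewrite rdivE rl_mul1x sdlE lact1 leEprod /= => -> ->.
Qed.

End NagataProductP.

Definition nagata (B : bimodule) : nagataLattice := NagataLattice (nagataP B).

Section RestrictedNagataProduct.
Variable B : bimodule.
Implicit Types (a b c : scal B) (x y z : modl B).
Implicit Types p q r : nagata_ops B.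

Definition restricted : {pred nagata_car B} :=
  fun p => (pt <* p.1 <= p.2) && (p.1 *> pt <= p.2).

Lemma restrictedE p : (p \in restricted) = (p.1 *> pt <= p.2).
Proof. by rewrite /in_mem /= /restricted pt_cyclic andbb. Qed.

Lemma restrictedI : meet_closed restricted.
Proof.
move=> [a x] [b y]; rewrite !restrictedE /= lexI => ax byy.
by rewrite (le_trans _ ax) ?(le_trans _ byy) // lact_homo // ?leIl ?leIr.
Qed.

Lemma restrictedU : join_closed restricted.
Proof.
move=> [a x] [b y]; rewrite !restrictedE /= lact_joinl => ax byy.
by rewrite leU2.
Qed.

Lemma restrictedM p q : p \in restricted -> q \in restricted ->
  p ** q \in restricted.
Proof.
case: p q => a x [b y]; rewrite !restrictedE /= => ax _.
by rewrite -pt_lact (le_trans _ (leUl _ _)) // ract_homo.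
Qed.

Lemma restricted_ldiv p q : p \in restricted -> q \in restricted ->
  ldiv p q \in restricted.
Proof.
case: p q => a x [b y]; rewrite !restrictedE /= => ax _.
rewrite mdlE -lactA -pt_lact -sdrE (le_trans (leIr _ _)) //.
by rewrite sdrE (le_trans _ (ract_sdr x y)) // ract_homo.
Qed.

Lemma restricted_rdiv p q : p \in restricted -> q \in restricted ->
  rdiv q p \in restricted.
Proof.
case: p q => a x [b y]; rewrite !restrictedE /= => ax _.
rewrite mdrE lractA -pt_cyclic -sdlE (le_trans (leIr _ _)) //.
by rewrite sdlE (le_trans _ (lact_sdl x y)) // lact_homo.
Qed.

Lemma restricted_s p : sigma p \in restricted.
Proof. by rewrite restrictedE /=. Qed.

Lemma restricted_g p : gamma p \in restricted.
Proof. by rewrite restrictedE /= lact_ptE. Qed.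

Lemma restricted1 : (nl1 : nagata_ops B) \in restricted.
Proof. by rewrite restrictedE /= lact1. Qed.

Lemma restricted0 : (nl0 : nagata_ops B) \in restricted.
Proof. exact: (restricted_g nl1). Qed.

Definition rnagata_car := {p : nagata_car B | p \in restricted}.
HB.instance Definition _ := SubChoice.on rnagata_car.
HB.instance Definition _ := Order.SubChoice_isSubLattice.Build _ _ _ disp
  rnagata_car restrictedI restrictedU.
Implicit Types u v w : rnagata_car.

Definition rnagata_mul u v : rnagata_car :=
  Sub ((val u : nagata_ops B) ** val v) (restrictedM (valP u) (valP v)).
Definition rnagata_ldiv u v : rnagata_car :=
  Sub (ldiv (val u : nagata_ops B) (val v)) (restricted_ldiv (valP u) (valP v)).
Definition rnagata_rdiv u v : rnagata_car :=
  Sub (rdiv (val u : nagata_ops B) (val v)) (restricted_rdiv (valP v) (valP u)).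

Lemma rnagata_mulA : associative rnagata_mul.
Proof. by move=> u v w; apply: val_inj; exact: nagata_mulA. Qed.

Lemma rnagata_ldivE u v w : (v <= rnagata_ldiv u w) = (rnagata_mul u v <= w).
Proof. by exact: nagata_ldivE. Qed.

Lemma rnagata_rdivE u v w : (u <= rnagata_rdiv w v) = (rnagata_mul u v <= w).
Proof. by exact: nagata_rdivE. Qed.

Definition rnagata_ops : nagataOps :=
  @NagataOps (ResLSemigroup rnagata_mulA rnagata_ldivE rnagata_rdivE)
    (fun u => Sub (sigma (val u : nagata_ops B)) (restricted_s (val u)) : rnagata_car)
    (fun u => Sub (gamma (val u : nagata_ops B)) (restricted_g (val u)) : rnagata_car)
    (Sub nl1 restricted1 : rnagata_car)
    (Sub nl0 restricted0 : rnagata_car).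

Lemma rnagata_le (u v : rnagata_ops) :
  (u <= v) = ((val u : nagata_ops B) <= val v).
Proof. by []. Qed.

Lemma restricted_sle p : p \in restricted -> sigma p <= p.
Proof. by rewrite leEprod restrictedE => /= ->; rewrite lexx. Qed.

Lemma restricted_gle p : p \in restricted -> p <= gamma p.
Proof. by rewrite leEprod restrictedE /= lact_ptE => ->; rewrite lexx. Qed.

Lemma rnagata_join (u v : rnagata_ops) :
  val (u `|` v) = (val u : nagata_ops B) `|` val v.
Proof. by []. Qed.

Lemma rnagata_meet (u v : rnagata_ops) :
  val (u `&` v) = (val u : nagata_ops B) `&` val v.
Proof. by []. Qed.

Lemma rnagataP : is_rnagata rnagata_ops.
Proof.
split.
- move=> [[b y] ry]; apply: val_inj; congr pair; rewrite /= ?rl_mul1x // lact1.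
  by apply: join_r; have /andP[] := ry.
- move=> [[b y] ry]; apply: val_inj; congr pair; rewrite /= ?rl_mulx1 // ract1.
  by apply: join_l; have /andP[] := ry.
- split.
  + by move=> u; rewrite rnagata_le restricted_sle // (valP u).
  + by move=> u; apply: val_inj.
  + by move=> u v; rewrite !rnagata_le; exact: nagata_s_homo.
  + by move=> u v; rewrite rnagata_le le_eqVlt; apply/orP; left; apply/eqP;
    apply/esym; exact: nagata_sM.
- by apply: val_inj; rewrite /= /e_S /= lact1.
- split.
  + by move=> u; rewrite rnagata_le restricted_gle // (valP u).
  + by move=> u; apply: val_inj.
  + by move=> u v; rewrite !rnagata_le; exact: nagata_g_homo.
- split=> _ m [u _ <-]; rewrite rnagata_le; have [sl sr] := nagata_structural B;
    [apply: sl|apply: sr]; exact: rangeI.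
- by exists (Sub nl1 restricted1) => //; apply: val_inj.
- by move=> u v; apply: val_inj; exact: nagata_sM.
- move=> [[a x] ax] [[b y] byy]; apply: val_inj.
  rewrite rnagata_join /=; congr pair => /=; rewrite ?joinxx //.
  move: ax byy; rewrite !restrictedE /= => ax byy.
  have -> : (a *> pt) <* b `|` a *> y = a *> y.
    by apply: join_r; rewrite lractA lact_homo // -pt_cyclic.
  have -> : x <* b `|` a *> (b *> pt) = x <* b.
    by apply: join_l; rewrite -lactA -pt_lact ract_homo.
  by rewrite joinC.
- move=> [[a x] ax] [[b y] byy]; apply: val_inj; rewrite rnagata_meet /=.
  move: ax byy; rewrite !restrictedE /= => ax byy.
  congr pair => /=; rewrite ?meetxx //; apply: le_eqP => c; rewrite !lexI.
  case cx: (c <= sdr x y); last by rewrite !andbF.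
  rewrite sdrE in cx.
  have -> : c <= sdr (a *> pt) y by rewrite sdrE (le_trans _ cx) // ract_homo.
  have -> : c <= ldiv a (sdr pt y).
    by rewrite ldivE -lact_ptE -pt_lact (le_trans _ cx) // ract_homo.
  by rewrite !andbT.
- move=> [[b y] byy] [[a x] ax]; apply: val_inj; rewrite rnagata_meet /=.
  move: ax byy; rewrite !restrictedE /= => ax byy.
  congr pair => /=; rewrite ?meetxx //; apply: le_eqP => c; rewrite !lexI.
  case cx: (c <= sdl y x); last by rewrite !andbF.
  rewrite sdlE in cx.
  have -> : c <= sdl y (a *> pt) by rewrite sdlE (le_trans _ cx) // lact_homo.
  have -> : c <= rdiv (sdr pt y) a.
    by rewrite rdivE -lact_ptE lactA (le_trans _ cx) // lact_homo.
  by rewrite !andbT.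
- by move=> u v; apply: val_inj; exact: nagata_gl.
- by move=> u v; apply: val_inj; exact: nagata_gr.
- by move=> u; apply: val_inj; exact: nagata_sgl.
- by move=> u; apply: val_inj; exact: nagata_sgr.
- by move=> u; apply: val_inj; exact: nagata_gsl.
- by move=> u; apply: val_inj; exact: nagata_gsr.
- by move=> u v; apply: val_inj; exact: nagata_sU.
- by move=> u v; apply: val_inj; exact: nagata_gI.
Qed.

End RestrictedNagataProduct.

Definition rnagata (B : bimodule) : rnagataLattice := RNagataLattice (rnagataP B).

(* What the construction of the structural bimodule uses: a common           *)
(* consequence of the two axiomatizations.                                   *)
Record has_structural (N : nagataOps) : Prop := HasStructural {
  hs_s : idempotent_fun (@sigma N);
  hs_g : idempotent_fun (@gamma N);
  hs_sh : {homo @sigma N : x y / x <= y};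
  hs_gh : {homo @gamma N : x y / x <= y};
  hs_M : forall a b : N, range (@sigma N) a -> range (@sigma N) b -> range (@sigma N) (a ** b);
  hs_U : forall a b : N, range (@sigma N) a -> range (@sigma N) b -> range (@sigma N) (a `|` b);
  hs_I : forall x y : N, range (@gamma N) x -> range (@gamma N) y -> range (@gamma N) (x `&` y);
  hs_l : forall a x : N, range (@sigma N) a -> range (@gamma N) x ->
    a ** x <= gamma (a ** x);
  hs_r : forall a x : N, range (@sigma N) a -> range (@gamma N) x ->
    x ** a <= gamma (x ** a);
  hs_str : structural (@sigma N) (@gamma N);
  hs_1 : range (@sigma N) nl1;
  hs_0 : range (@gamma N) nl0;
  hs_ssl : forall a b : N, range (@sigma N) a -> range (@sigma N) b ->
    a ** sigma (ldiv a b) <= b;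
  hs_ssr : forall a b : N, range (@sigma N) a -> range (@sigma N) b ->
    sigma (rdiv b a) ** a <= b;
  hs_ggl : forall x y : N, range (@gamma N) x -> range (@gamma N) y ->
    x ** sigma (ldiv x y) <= y;
  hs_ggr : forall x y : N, range (@gamma N) x -> range (@gamma N) y ->
    sigma (rdiv y x) ** x <= y;
  hs_sgl : forall a y : N, range (@sigma N) a -> range (@gamma N) y ->
    a ** gamma (ldiv a y) <= y;
  hs_sgr : forall a y : N, range (@sigma N) a -> range (@gamma N) y ->
    gamma (rdiv y a) ** a <= y;
  hs_1x : forall a : N, range (@sigma N) a -> nl1 ** a = a;
  hs_x1 : forall a : N, range (@sigma N) a -> a ** nl1 = a;
  hs_g1x : forall x : N, range (@gamma N) x -> gamma (nl1 ** x) = x;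
  hs_gx1 : forall x : N, range (@gamma N) x -> gamma (x ** nl1) = x;
  hs_cyc : forall a : N, range (@sigma N) a -> gamma (a ** nl0) = gamma (nl0 ** a) }.

Section NagataStructural.
Variables (N : nagataOps) (HN : is_nagata N).
Implicit Types x y z : N.

Let one_s : sigma (@nl1 N) = nl1.
Proof. by apply: rangeE; [case: (nl_sigma HN) | exact: nl_one]. Qed.

Lemma nl_sh : {homo @sigma N : x y / x <= y}.
Proof. by case: (nl_sigma HN). Qed.
Lemma nl_gh : {homo @gamma N : x y / x <= y}.
Proof. by case: (nl_gamma HN). Qed.
Lemma nl_ss : idempotent_fun (@sigma N).
Proof. by case: (nl_sigma HN). Qed.
Lemma nl_gg : idempotent_fun (@gamma N).
Proof. by case: (nl_gamma HN). Qed.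

Lemma nl_leE x y : (x <= y) = (sigma x <= sigma y) && (gamma x <= gamma y).
Proof.
apply/idP/andP => [xy|[sxy gxy]]; first by rewrite nl_sh ?nl_gh.
apply: (nl_lel HN); rewrite (nl_sl HN) (nl_sI HN) -[leLHS]one_s.
apply: nl_sh; rewrite lexI; apply/andP; split.
  by rewrite (le_trans (nl_1l HN (sigma x))) // nl_sh // ldiv_homo.
by rewrite (le_trans (nl_1l HN (gamma x))) // nl_sh // ldiv_homo.
Qed.

Lemma nl_inj x y : sigma x = sigma y -> gamma x = gamma y -> x = y.
Proof. by move=> sxy gxy; apply/le_anti/andP; split; rewrite nl_leE ?sxy ?gxy !lexx. Qed.

Let gsl x y : sigma x ** gamma y <= gamma (x ** y).
Proof.
rewrite (nl_gM HN) (le_trans (sc_l (nl_gamma HN) (rangeI _ x) (rangeI _ y))) //.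
by rewrite nl_gh // leUl.
Qed.

Let gsr x y : gamma x ** sigma y <= gamma (x ** y).
Proof.
rewrite (nl_gM HN) (le_trans (sc_r (nl_gamma HN) (rangeI _ y) (rangeI _ x))) //.
by rewrite nl_gh // leUr.
Qed.

Let ssE (a : N) : range (@sigma N) a -> sigma a = a.
Proof. exact: (rangeE nl_ss). Qed.
Let ggE (a : N) : range (@gamma N) a -> gamma a = a.
Proof. exact: (rangeE nl_gg). Qed.

Let ssl a b : range (@sigma N) a -> range (@sigma N) b -> a ** sigma (ldiv a b) <= b.
Proof.
by move=> /ssE {1}<- /ssE bE; rewrite -(nl_sM HN) -[leRHS]bE nl_sh // mul_ldiv.
Qed.

Let ssr a b : range (@sigma N) a -> range (@sigma N) b -> sigma (rdiv b a) ** a <= b.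
Proof.
by move=> /ssE {2}<- /ssE bE; rewrite -(nl_sM HN) -[leRHS]bE nl_sh // mul_rdiv.
Qed.

Let ggl x y : range (@gamma N) x -> range (@gamma N) y -> x ** sigma (ldiv x y) <= y.
Proof.
move=> /ggE {1}<- /ggE yE; rewrite (le_trans (gsr _ _)) //.
by rewrite -[leRHS]yE nl_gh // mul_ldiv.
Qed.

Let ggr x y : range (@gamma N) x -> range (@gamma N) y -> sigma (rdiv y x) ** x <= y.
Proof.
move=> /ggE {2}<- /ggE yE; rewrite (le_trans (gsl _ _)) //.
by rewrite -[leRHS]yE nl_gh // mul_rdiv.
Qed.

Let le1x x : x <= nl1 ** x.
Proof.
apply: (nl_ler HN); rewrite -[leLHS]one_s.
by apply: nl_sh; rewrite rdivE.
Qed.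

Let lex1 x : x <= x ** nl1.
Proof.
apply: (nl_lel HN); rewrite -[leLHS]one_s.
by apply: nl_sh; rewrite ldivE.
Qed.

Lemma nagata_has_structural : has_structural N.
Proof.
split.
- exact: nl_ss.
- exact: nl_gg.
- exact: nl_sh.
- exact: nl_gh.
- by case: (nl_sigma HN).
- by move=> a b /ssE <- /ssE <-; rewrite -(nl_sU HN); exact: rangeI.
- by move=> a b /ggE <- /ggE <-; rewrite -(nl_gI HN); exact: rangeI.
- by case: (nl_gamma HN).
- by case: (nl_gamma HN).
- exact: nl_str HN.
- exact: nl_one HN.
- exact: nl_zero HN.
- exact: ssl.
- exact: ssr.
- exact: ggl.
- exact: ggr.
- move=> a y /ssE {1}<- yg; rewrite (le_trans (gsl _ _)) //.
  by rewrite -[leRHS](ggE yg) nl_gh // mul_ldiv.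
- move=> a y /ssE {2}<- yg; rewrite (le_trans (gsr _ _)) //.
  by rewrite -[leRHS](ggE yg) nl_gh // mul_rdiv.
- move=> a sa; apply/le_anti; rewrite le1x andbT -rdivE.
  by rewrite rdivE (le_trans _ (ssr sa sa)) // mul_homo // (nl_1r HN).
- move=> a sa; apply/le_anti; rewrite lex1 andbT.
  by rewrite (le_trans _ (ssl sa sa)) // mul_homo // (nl_1l HN).
- move=> x gx; rewrite -[RHS](ggE gx); congr gamma.
  apply/le_anti; rewrite le1x andbT.
  by rewrite (le_trans _ (ggr gx gx)) // mul_homo // (nl_1r HN).
- move=> x gx; rewrite -[RHS](ggE gx); congr gamma.
  apply/le_anti; rewrite lex1 andbT.
  by rewrite (le_trans _ (ggl gx gx)) // mul_homo // (nl_1l HN).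
- by move=> a /ssE <-; rewrite -(nl_gsr HN) -(nl_gsl HN).
Qed.

End NagataStructural.

Section RNagataStructural.
Variables (N : nagataOps) (HN : is_rnagata N).
Implicit Types x y z : N.

Lemma rn_sh : {homo @sigma N : x y / x <= y}.
Proof. by case: (rn_sigma HN). Qed.
Lemma rn_gh : {homo @gamma N : x y / x <= y}.
Proof. by case: (rn_gamma HN). Qed.
Lemma rn_ss : idempotent_fun (@sigma N).
Proof. by case: (rn_sigma HN). Qed.
Lemma rn_gg : idempotent_fun (@gamma N).
Proof. by case: (rn_gamma HN). Qed.
Lemma rn_sle x : sigma x <= x.
Proof. by case: (rn_sigma HN). Qed.
Lemma rn_gle x : x <= gamma x.
Proof. by case: (rn_gamma HN). Qed.

Lemma rn_leE x y : (x <= y) = (sigma x <= sigma y) && (gamma x <= gamma y).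
Proof.
apply/idP/andP => [xy|[sxy gxy]]; first by rewrite rn_sh ?rn_gh.
rewrite -[leLHS](rn_mulx1 HN) -ldivE -(rn_l HN) lexI !ldivE !(rn_mulx1 HN).
by rewrite (le_trans sxy) ?rn_sle // (le_trans _ gxy) ?rn_gle.
Qed.

Lemma rn_inj x y : sigma x = sigma y -> gamma x = gamma y -> x = y.
Proof. by move=> sxy gxy; apply/le_anti/andP; split; rewrite rn_leE ?sxy ?gxy !lexx. Qed.

Let ssE (a : N) : range (@sigma N) a -> sigma a = a.
Proof. exact: (rangeE rn_ss). Qed.
Let ggE (a : N) : range (@gamma N) a -> gamma a = a.
Proof. exact: (rangeE rn_gg). Qed.

Lemma rnagata_has_structural : has_structural N.
Proof.
split.
- exact: rn_ss.
- exact: rn_gg.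
- exact: rn_sh.
- exact: rn_gh.
- by move=> a b /ssE <- /ssE <-; rewrite -(rn_sM HN); exact: rangeI.
- by move=> a b /ssE <- /ssE <-; rewrite -(rn_sU HN); exact: rangeI.
- by move=> a b /ggE <- /ggE <-; rewrite -(rn_gI HN); exact: rangeI.
- by move=> *; exact: rn_gle.
- by move=> *; exact: rn_gle.
- exact: rn_str HN.
- by exists nl1 => //; exact: rn_s1.
- exact: rn_zero HN.
- by move=> a b _ _; rewrite (le_trans _ (mul_ldiv a b)) // mul_homo // rn_sle.
- by move=> a b _ _; rewrite (le_trans _ (mul_rdiv a b)) // mul_homo // rn_sle.
- by move=> a b _ _; rewrite (le_trans _ (mul_ldiv a b)) // mul_homo // rn_sle.
- by move=> a b _ _; rewrite (le_trans _ (mul_rdiv a b)) // mul_homo // rn_sle.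
- by move=> a y /ssE aE /ggE yE; rewrite -(rn_gl HN) aE yE mul_ldiv.
- by move=> a y /ssE aE /ggE yE; rewrite -(rn_gr HN) aE yE mul_rdiv.
- by move=> a _; rewrite (rn_mul1x HN).
- by move=> a _; rewrite (rn_mulx1 HN).
- by move=> a /ggE aE; rewrite (rn_mul1x HN).
- by move=> a /ggE aE; rewrite (rn_mulx1 HN).
- by move=> a /ssE <-; rewrite -(rn_gsr HN) -(rn_gsl HN).
Qed.

End RNagataStructural.

Section StructuralBimodule.
Variables (N : nagataOps) (H : has_structural N).

(* The proof argument makes the lattice structures below canonical: they     *)
(* differ from those of sublattices of N and rely on has_structural.         *)
Definition Nsigma (_ : has_structural N) : Type := range (@sigma N).
Definition Ngamma (_ : has_structural N) : Type := range (@gamma N).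

HB.instance Definition _ := SubChoice.copy (Nsigma H) (range (@sigma N)).
HB.instance Definition _ := SubChoice.copy (Ngamma H) (range (@gamma N)).
HB.instance Definition _ :=
  Order.SubChoice_isSubPOrder.Build _ _ _ disp (Nsigma H).
HB.instance Definition _ :=
  Order.SubChoice_isSubPOrder.Build _ _ _ disp (Ngamma H).

Implicit Types (a b c : Nsigma H) (x y z : Ngamma H).

Definition inS (m : N) (h : range (@sigma N) m) : Nsigma H :=
  exist _ m (mem_set h).
Definition inG (m : N) (h : range (@gamma N) m) : Ngamma H :=
  exist _ m (mem_set h).
Definition toS (m : N) : Nsigma H := inS (rangeI sigma m).
Definition toG (m : N) : Ngamma H := inG (rangeI gamma m).

Lemma rS a : range (@sigma N) (val a). Proof. exact: set_mem (valP a). Qed.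
Lemma rG x : range (@gamma N) (val x). Proof. exact: set_mem (valP x). Qed.
Lemma sK a : sigma (val a) = val a. Proof. exact: rangeE (hs_s H) (rS a). Qed.
Lemma gK x : gamma (val x) = val x. Proof. exact: rangeE (hs_g H) (rG x). Qed.

Lemma leS a b : (a <= b) = ((val a : N) <= val b). Proof. by []. Qed.
Lemma leG x y : (x <= y) = ((val x : N) <= val y). Proof. by []. Qed.

Lemma sigma_le a (m : N) : (val a : N) <= m -> (val a : N) <= sigma m.
Proof. by move=> am; rewrite -sK; exact: hs_sh. Qed.
Lemma gamma_le x (m : N) : (val x : N) <= m -> (val x : N) <= gamma m.
Proof. by move=> am; rewrite -gK; exact: hs_gh. Qed.
Lemma gamma_ge x (m : N) : m <= val x -> gamma m <= val x.
Proof. by move=> am; rewrite -[leRHS]gK; exact: hs_gh. Qed.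
Lemma sigma_ge a (m : N) : m <= val a -> sigma m <= val a.
Proof. by move=> am; rewrite -[leRHS]sK; exact: hs_sh. Qed.

Definition meetS a b : Nsigma H := toS ((val a : N) `&` val b).
Definition joinS a b : Nsigma H := inS (hs_U H (rS a) (rS b)).
Definition meetG x y : Ngamma H := inG (hs_I H (rG x) (rG y)).
Definition joinG x y : Ngamma H := toG ((val x : N) `|` val y).

Lemma meetSP a b c : (a <= meetS b c) = (a <= b) && (a <= c).
Proof.
rewrite !leS /=; apply/idP/andP => [h|[ab ac]].
  by split; apply: (le_trans h); apply: sigma_ge; rewrite ?leIl ?leIr.
by apply: sigma_le; rewrite lexI ab.
Qed.

Lemma joinSP a b c : (joinS a b <= c) = (a <= c) && (b <= c).
Proof. by rewrite !leS /= leUx. Qed.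

Lemma meetGP x y z : (x <= meetG y z) = (x <= y) && (x <= z).
Proof. by rewrite !leG /= lexI. Qed.

Lemma joinGP x y z : (joinG x y <= z) = (x <= z) && (y <= z).
Proof.
rewrite !leG /=; apply/idP/andP => [h|[ab ac]].
  by split; apply: (le_trans _ h); apply: gamma_le; rewrite ?leUl ?leUr.
by apply: gamma_ge; rewrite leUx ab.
Qed.

HB.instance Definition _ :=
  Order.POrder_MeetJoin_isLattice.Build disp (Nsigma H) meetSP joinSP.
HB.instance Definition _ :=
  Order.POrder_MeetJoin_isLattice.Build disp (Ngamma H) meetGP joinGP.

Definition mulS a b : Nsigma H := inS (hs_M H (rS a) (rS b)).
Definition ldivS a b : Nsigma H := toS (ldiv (val a) (val b)).
Definition rdivS b a : Nsigma H := toS (rdiv (val b) (val a)).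

Lemma mulSA : associative mulS.
Proof. by move=> a b c; apply: val_inj; exact: mulA. Qed.

Lemma ldivSE a b c : (b <= ldivS a c) = (mulS a b <= c).
Proof.
rewrite !leS /=; apply/idP/idP => h.
  by rewrite (le_trans _ (hs_ssl H (rS a) (rS c))) // mul_homo.
by apply: sigma_le; rewrite ldivE.
Qed.

Lemma rdivSE a b c : (a <= rdivS c b) = (mulS a b <= c).
Proof.
rewrite !leS /=; apply/idP/idP => h.
  by rewrite (le_trans _ (hs_ssr H (rS b) (rS c))) // mul_homo.
by apply: sigma_le; rewrite rdivE.
Qed.

Lemma mulS1x : left_id (inS (hs_1 H)) mulS.
Proof. by move=> a; apply: val_inj; rewrite /= (hs_1x H) //; exact: rS. Qed.

Lemma mulSx1 : right_id (inS (hs_1 H)) mulS.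
Proof. by move=> a; apply: val_inj; rewrite /= (hs_x1 H) //; exact: rS. Qed.

Definition Nsigma_lattice : resLattice :=
  @ResLattice (ResLSemigroup mulSA ldivSE rdivSE) _ mulS1x mulSx1.

Definition lactN a x : Ngamma H := toG (val a ** val x).
Definition ractN x a : Ngamma H := toG (val x ** val a).
Definition mdlN a y : Ngamma H := toG (ldiv (val a) (val y)).
Definition sdlN y x : Nsigma H := toS (rdiv (val y) (val x)).
Definition sdrN x y : Nsigma H := toS (ldiv (val x) (val y)).
Definition mdrN y a : Ngamma H := toG (rdiv (val y) (val a)).

Lemma lactN_le a x y : (lactN a x <= y) = (val a ** val x <= val y).
Proof.
rewrite leG; apply/idP/idP => [|h]; last exact: gamma_ge.
by apply: le_trans; apply: (hs_l H); [exact: rS|exact: rG].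
Qed.

Lemma ractN_le a x y : (ractN x a <= y) = (val x ** val a <= val y).
Proof.
rewrite leG; apply/idP/idP => [|h]; last exact: gamma_ge.
by apply: le_trans; apply: (hs_r H); [exact: rS|exact: rG].
Qed.

Lemma gamma_lact a (m : N) : m <= gamma m ->
  gamma (val a ** gamma m) = gamma (val a ** m).
Proof.
move=> mg; apply/le_anti/andP; split; last first.
  by apply: (hs_gh H); rewrite mul_homo.
rewrite -[leRHS](hs_g H); apply: (hs_gh H).
by case: (hs_str H) => h _; apply: h; exact: rS.
Qed.

Lemma gamma_ract a (m : N) : m <= gamma m ->
  gamma (gamma m ** val a) = gamma (m ** val a).
Proof.
move=> mg; apply/le_anti/andP; split; last first.
  by apply: (hs_gh H); rewrite mul_homo.
rewrite -[leRHS](hs_g H); apply: (hs_gh H).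
by case: (hs_str H) => _ h; apply: h; exact: rS.
Qed.

Let le_l a x : val a ** val x <= gamma (val a ** val x).
Proof. by apply: (hs_l H); [exact: rS|exact: rG]. Qed.
Let le_r a x : val x ** val a <= gamma (val x ** val a).
Proof. by apply: (hs_r H); [exact: rS|exact: rG]. Qed.

Definition structural_bimodule : bimodule.
Proof.
refine (@Bimodule Nsigma_lattice (Ngamma H) lactN ractN mdlN sdlN sdrN mdrN
  (inG (hs_0 H)) _ _ _ _ _ _ _ _ _ _ _ _).
- by move=> a b x y ab xy; apply: (hs_gh H); apply: mul_homo.
- by move=> a b x y ab xy; apply: (hs_gh H); apply: mul_homo.
- move=> a b x; apply: val_inj; rewrite /= gamma_lact; last exact: le_l b x.
  by congr (gamma _); rewrite -mulA.
- move=> a b x; apply: val_inj; rewrite /= gamma_ract; last exact: le_r a x.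
  by congr (gamma _); rewrite mulA.
- move=> a b x; apply: val_inj.
  rewrite /= gamma_lact ?gamma_ract; [|exact: le_l a x|exact: le_r b x].
  by congr (gamma _); rewrite mulA.
- move=> a x y; rewrite lactN_le leG; apply/idP/idP => h.
    by rewrite (le_trans _ (hs_sgl H (rS a) (rG y))) // mul_homo.
  by apply: gamma_le; rewrite ldivE.
- move=> a x y; rewrite lactN_le leS; apply/idP/idP => h.
    by rewrite (le_trans _ (hs_ggr H (rG x) (rG y))) // mul_homo.
  by apply: sigma_le; rewrite rdivE.
- move=> a x y; rewrite ractN_le leG; apply/idP/idP => h.
    by rewrite (le_trans _ (hs_sgr H (rS a) (rG y))) // mul_homo.
  by apply: gamma_le; rewrite rdivE.
- move=> a x y; rewrite ractN_le leS; apply/idP/idP => h.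
    by rewrite (le_trans _ (hs_ggl H (rG x) (rG y))) // mul_homo.
  by apply: sigma_le; rewrite ldivE.
- by move=> x; apply: val_inj; apply: (hs_g1x H); exact: rG.
- by move=> x; apply: val_inj; apply: (hs_gx1 H); exact: rG.
- by move=> a; apply: val_inj; apply: (hs_cyc H); exact: rS.
Defined.

End StructuralBimodule.

Section StructuralHom.
Variables (N N' : nagataOps) (H : has_structural N) (H' : has_structural N').
Variable f : nagata_hom N N'.

Lemma hom_range_sigma (a : N) : range (@sigma N) a -> range (@sigma N') (f a).
Proof. by case=> m _ <-; exists (f m) => //; case: (nagata_homP f). Qed.

Lemma hom_range_gamma (x : N) : range (@gamma N) x -> range (@gamma N') (f x).
Proof. by case=> m _ <-; exists (f m) => //; case: (nagata_homP f). Qed.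

Definition structural_hom :
  bimodule_hom (structural_bimodule H) (structural_bimodule H').
Proof.
refine (@BimoduleHom (structural_bimodule H) (structural_bimodule H')
  (fun a : Nsigma H => inS H' (hom_range_sigma (rS a)))
  (fun x : Ngamma H => inG H' (hom_range_gamma (rG x))) _).
have [[h1 h2 h3 h4 h5] hs hg ho hz] := nagata_homP f.
split; first split; rewrite /=;
by repeat (move=> ?); apply: val_inj; rewrite /= ?(hs, hg) ?(h1, h2, h3, h4, h5).
Defined.

End StructuralHom.

Definition structural_functor : functor nagata_cat bimodule_cat.
Proof.
apply: (@Functor nagata_cat bimodule_cat
  (fun N => structural_bimodule (nagata_has_structural (nlP N)))
  (fun N N' f => structural_hom _ _ f)).
- by move=> N; apply: bimodule_hom_eq => x; apply: val_inj.
- by move=> *; apply: bimodule_hom_eq => x; apply: val_inj.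
Defined.

Definition rstructural_functor : functor rnagata_cat bimodule_cat.
Proof.
apply: (@Functor rnagata_cat bimodule_cat
  (fun N => structural_bimodule (rnagata_has_structural (rnP N)))
  (fun N N' f => structural_hom _ _ f)).
- by move=> N; apply: bimodule_hom_eq => x; apply: val_inj.
- by move=> *; apply: bimodule_hom_eq => x; apply: val_inj.
Defined.

Section NagataHom.
Variables (B B' : bimodule) (h : bimodule_hom B B').

Definition nagata_map (p : nagata_ops B) : nagata_ops B' :=
  (hscal h p.1, hmodl h p.2).

Definition nagata_fmap : nagata_hom (nagata_ops B) (nagata_ops B').
Proof.
apply: (@NagataHom _ _ nagata_map).
rewrite /nagata_map.
case: h => f g [[f1 f2 f3 f4 f5] fo g1 g2 g3 g4 g5 g6 g7 g8 g9] /=.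
split; first split; repeat (move=> [? ?]); congr pair;
  by rewrite /= ?(f1, f2, f3, f4, f5, fo) ?(g1, g2, g3, g4, g5, g6, g7, g8, g9)
    ?(f1, f2, f3, f4, f5, fo) ?(g1, g2, g3, g4, g5, g6, g7, g8, g9).
Defined.

Lemma nagata_map_restricted (p : nagata_ops B) :
  p \in @restricted B -> nagata_map p \in @restricted B'.
Proof.
rewrite !restrictedE /= => hp; case: h => f g [_ _ gI _ gl _ _ _ _ _ g0] /=.
by apply/meet_idPl; rewrite -g0 -gl -gI (meet_idPl hp).
Qed.

Definition rnagata_map (u : rnagata_ops B) : rnagata_ops B' :=
  exist _ (nagata_map (val u)) (nagata_map_restricted (valP u)).

Definition rnagata_fmap : nagata_hom (rnagata_ops B) (rnagata_ops B').
Proof.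
apply: (@NagataHom _ _ rnagata_map).
have [[h1 h2 h3 h4 h5] hs hg ho hz] := nagata_homP nagata_fmap.
split; first split; repeat move=> ?; apply: val_inj;
[exact: h1|exact: h2|exact: h3|exact: h4|exact: h5|exact: hs|exact: hg
|exact: ho|exact: hz].
Defined.

End NagataHom.

Definition nagata_functor : functor bimodule_cat nagata_cat.
Proof.
apply: (@Functor bimodule_cat nagata_cat nagata nagata_fmap).
- by move=> B; apply: nagata_hom_eq => -[].
- by move=> *; apply: nagata_hom_eq => -[].
Defined.

Definition rnagata_functor : functor bimodule_cat rnagata_cat.
Proof.
apply: (@Functor bimodule_cat rnagata_cat rnagata rnagata_fmap).
- by move=> B; apply: nagata_hom_eq => -[[a x] p]; apply: val_inj.
- by move=> *; apply: nagata_hom_eq => -[[a x] p]; apply: val_inj.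
Defined.

(* Main.v *)
Require Import Defs.
From mathcomp Require Import all_boot all_order.
From mathcomp Require Import boolp classical_sets.

(* A restricted Nagata lattice is a Nagata lattice, so both adjunctions come  *)
(* from one computation. The laws of Nagata lattices say precisely that       *)
(* m |-> (sigma m, gamma m) is a morphism into the Nagata product of the      *)
(* structural bimodule, landing in the restricted product when gamma          *)
(* (sigma m) <= gamma m. In the other direction, N_sigma and N_gamma in a     *)
(* Nagata product are the graphs of a |-> a * 0 and of x |-> 0 \_r x, so the  *)
(* two projections form an isomorphism onto the original bimodule.            *)

Set Implicit Arguments.
Unset Strict Implicit.
Unset Printing Implicit Defensive.

Import Order.TTheory.
Local Open Scope order_scope.

(** An element [m] is determined by [sigma m] and [gamma m] ([nl_leE]), so the morphism of
    [unit_fun_morph] is an embedding; [rnagata_is_nagata] carries this over to the restricted case.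
    The counit reads off first coordinates on scalars, which [sigma] leaves alone, and second
    coordinates on the module, which [gamma] leaves alone; so the projections form a morphism
    ([counit_morph]). One triangle identity then says that [sigma] and [gamma] are identities on
    their images, the other that [a] and [x] are read off from [e_S a] and [e_M x]. *)

(** * Restricted Nagata lattices satisfy the laws of Nagata lattices *)

Section RestrictedNagata.
Variables (N : nagataOps) (HN : is_rnagata N).
Implicit Types x y : N.

Let sh x y : x <= y -> sigma x <= sigma y. Proof. exact: rn_sh. Qed.
Let gh x y : x <= y -> gamma x <= gamma y. Proof. exact: rn_gh. Qed.
Let sle x : sigma x <= x. Proof. exact: rn_sle. Qed.
Let gle x : x <= gamma x. Proof. exact: rn_gle. Qed.
Let ss x : sigma (sigma x) = sigma x. Proof. exact: rn_ss. Qed.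
Let gg x : gamma (gamma x) = gamma x. Proof. exact: rn_gg. Qed.

Lemma rn_sI x y : sigma (x `&` y) = sigma (sigma x `&` sigma y).
Proof.
apply/le_anti/andP; split; last by rewrite sh // leI2.
by rewrite -ss sh // lexI !sh ?leIl ?leIr.
Qed.

Lemma rn_gU x y : gamma (x `|` y) = gamma (gamma x `|` gamma y).
Proof.
apply/le_anti/andP; split; first by rewrite gh // leU2.
by rewrite -[leRHS]gg gh // leUx !gh ?leUl ?leUr.
Qed.

(** One inequality is [rn_M] enlarged by [x <= gamma x] and [y <= gamma y]. For the other,
    structurality pulls [gamma] out of a product with a value of [sigma], and [sigma] is
    deflationary. *)
Lemma rn_gM x y : gamma (x ** y) = gamma (sigma x ** gamma y `|` gamma x ** sigma y).
Proof.
apply/le_anti/andP; split.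
  by rewrite gh // {1}(rn_M HN) leU2 // mul_homo.
rewrite -[leRHS]gg gh // leUx; apply/andP; split.
  rewrite (le_trans (str_l (rn_str HN) _ (rangeI _ _))) //.
  by rewrite gh // mul_homo.
rewrite (le_trans (str_r (rn_str HN) _ (rangeI _ _))) //.
by rewrite gh // mul_homo.
Qed.

(** For the left side below the right one, multiplicativity of [sigma] handles the first residual
    and structurality the second. Conversely the meet lies below that of [rn_l], since
    [sigma y <= y] and [x <= gamma x]. *)
Lemma rn_sl x y : sigma (ldiv x y)
  = sigma (ldiv (sigma x) (sigma y) `&` ldiv (gamma x) (gamma y)).
Proof.
apply/le_anti/andP; split; rewrite -[leLHS]ss sh //.
  rewrite lexI !ldivE; apply/andP; split.
    by rewrite -(rn_sM HN) sh // mul_ldiv.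
  rewrite (le_trans (str_r (rn_str HN) _ (rangeI _ _))) // gh //.
  by rewrite (le_trans _ (mul_ldiv x y)) // mul_homo.
rewrite -(rn_l HN x y) (le_trans (sle _)) // leI2 //;
  by rewrite ldiv_homo.
Qed.

Lemma rn_sr x y : sigma (rdiv y x)
  = sigma (rdiv (sigma y) (sigma x) `&` rdiv (gamma y) (gamma x)).
Proof.
apply/le_anti/andP; split; rewrite -[leLHS]ss sh //.
  rewrite lexI !rdivE; apply/andP; split.
    by rewrite -(rn_sM HN) sh // mul_rdiv.
  rewrite (le_trans (str_l (rn_str HN) _ (rangeI _ _))) // gh //.
  by rewrite (le_trans _ (mul_rdiv x y)) // mul_homo.
rewrite -(rn_r HN y x) (le_trans (sle _)) // leI2 //;
  by rewrite rdiv_homo.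
Qed.

Lemma rnagata_is_nagata : is_nagata N.
Proof.
have s1 : sigma (@nl1 N) = nl1 := rn_s1 HN.
split.
- split; [exact: ss | exact: sh |].
  by move=> _ _ [x _ <-] [y _ <-]; rewrite -(rn_sM HN); exact: rangeI.
- by split; [exact: gg | exact: gh | |] => *; exact: gle.
- exact: rn_str HN.
- by exists nl1.
- exact: rn_zero HN.
- exact: rn_sM HN.
- exact: rn_gM.
- exact: rn_sI.
- exact: rn_gU.
- exact: rn_sU HN.
- exact: rn_gI HN.
- exact: rn_sl.
- exact: rn_sr.
- exact: rn_gl HN.
- exact: rn_gr HN.
- exact: rn_sgl HN.
- exact: rn_sgr HN.
- exact: rn_gsl HN.
- exact: rn_gsr HN.
- by move=> x; rewrite -[leLHS]s1 sh // ldivE (rn_mulx1 HN).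
- by move=> x; rewrite -[leLHS]s1 sh // rdivE (rn_mul1x HN).
- by move=> x y /le_trans/(_ (sle _)); rewrite ldivE (rn_mulx1 HN).
- by move=> x y /le_trans/(_ (sle _)); rewrite rdivE (rn_mul1x HN).
Qed.

End RestrictedNagata.

(** * The unit as an embedding into the Nagata product *)

Section Unit.
Variables (N : nagataOps) (HN : is_nagata N) (H : has_structural N).

Definition unit_fun (m : N) : nagata_ops (structural_bimodule H) :=
  (toS H m, toG H m).

(** This is [nl_gsl] at [nl1]. It is what makes the unit send [nl1] to the constant [(rl1, pt)]. *)
Lemma nl_gamma1 : gamma (@nl1 N) = nl0.
Proof.
have s1 : sigma (@nl1 N) = nl1 by exact: rangeE (hs_s H) (hs_1 H).
by rewrite -{1}s1 (nl_gsl HN) s1 (hs_gx1 H) //; exact: hs_0.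
Qed.

Lemma unit_fun_morph : nagata_morph unit_fun.
Proof.
have pairE (a a' : Nsigma H) (x x' : Ngamma H) : val a = val a' -> val x = val x' ->
    (a, x) = (a', x') by move=> /val_inj -> /val_inj ->.
have gg (x : N) : gamma (gamma x) = gamma x := hs_g H x.
have ss (x : N) : sigma (sigma x) = sigma x := hs_s H x.
split; first split.
- by move=> x y; apply: pairE; [exact: nl_sI HN _ _ | exact: nl_gI HN _ _].
- by move=> x y; apply: pairE; [exact: nl_sU HN _ _ | exact: nl_gU HN _ _].
- move=> x y; apply: pairE; first exact: nl_sM HN _ _.
  (* Joins in [Ngamma] are closed by [gamma], as meets in [Nsigma] are by [sigma]; [nl_gU] here and
     [nl_sI] below absorb the inner closures. *)
  by rewrite /= (nl_gM HN) joinC [LHS](nl_gU HN).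
- move=> x y; apply: pairE => /=; first by rewrite (nl_sl HN) [LHS](nl_sI HN).
  by rewrite (nl_gl HN) gg.
- move=> x y; apply: pairE => /=; first by rewrite (nl_sr HN) [LHS](nl_sI HN).
  by rewrite (nl_gr HN) gg.
- by move=> x; apply: pairE => /=; [rewrite ss | rewrite (nl_gsr HN)].
- by move=> x; apply: pairE => /=; [rewrite (nl_sgl HN) | rewrite gg].
- apply: pairE => /=; last exact: nl_gamma1.
  exact: rangeE (hs_s H) (hs_1 H).
- have g0 : gamma (@nl0 N) = nl0 := rangeE (hs_g H) (hs_0 H).
  by apply: pairE => //=; rewrite -[in LHS]g0 (nl_sgl HN) g0.
Qed.

Definition unit_hom : nagata_hom N (nagata_ops (structural_bimodule H)) :=
  NagataHom unit_fun_morph.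

Lemma unit_hom_inj : injective unit_hom.
Proof. by move=> x y [sxy gxy]; exact: nl_inj HN _ _ sxy gxy. Qed.

End Unit.

Section RestrictedUnit.
Variables (N : nagataOps) (HN : is_rnagata N) (H : has_structural N).
Let HN' := rnagata_is_nagata HN.

(** By [nl_gsr], the scalar [sigma m] sends the point to [gamma (sigma m)], which is below [gamma m]
    because [sigma] is deflationary. *)
Lemma unit_hom_restricted (m : N) :
  unit_hom HN' H m \in @restricted (structural_bimodule H).
Proof.
rewrite restrictedE /= leG /= -(nl_gsr HN').
exact: rn_gh HN _ _ (rn_sle HN m).
Qed.

Definition runit_fun (m : N) : rnagata_ops (structural_bimodule H) :=
  exist _ (unit_hom HN' H m) (unit_hom_restricted m).

Lemma runit_fun_morph : nagata_morph runit_fun.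
Proof.
have [[h1 h2 h3 h4 h5] hs hg ho hz] := nagata_homP (unit_hom HN' H).
by split; first split; repeat move=> ?; apply: val_inj;
[exact: h1|exact: h2|exact: h3|exact: h4|exact: h5|exact: hs|exact: hg
|exact: ho|exact: hz].
Qed.

Definition runit_hom : nagata_hom N (rnagata_ops (structural_bimodule H)) :=
  NagataHom runit_fun_morph.

Lemma runit_hom_inj : injective runit_hom.
Proof. by move=> x y /(congr1 val)/(@unit_hom_inj _ HN' H). Qed.

End RestrictedUnit.

(** Each law for the inverse is checked after applying the injective [h]. This spares a direct
    verification for [e_S] and [e_M]. *)
Lemma bimodule_morph_can (B B' : bimodule) (h : bimodule_hom B B')
    (f : scal B' -> scal B) (g : modl B' -> modl B) :
  cancel (hscal h) f -> cancel f (hscal h) ->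
  cancel (hmodl h) g -> cancel g (hmodl h) -> bimodule_morph f g.
Proof.
move=> hf fh hg gh; have fI := can_inj hf; have gI := can_inj hg.
have [[h1 h2 h3 h4 h5] h6 h7 h8 h9 h10 h11 h12 h13 h14 h15] := bimodule_homP h.
split; first split; rewrite -?h6 -?h15 //; repeat (move=> ?);
  (apply: fI || apply: gI);
  by rewrite ?(h1, h2, h3, h4, h5) ?(h7, h8, h9, h10, h11, h12, h13, h14) !(fh, gh).
Qed.

(** * The projections from the structural bimodule of a Nagata product *)

Section Counit.
Variable B : bimodule.
Implicit Types (a b : scal B) (x y : modl B).

(** A residual in the Nagata product has a scalar and a module meetand. Between values of [e_S] the
    module one is absorbed; between values of [e_M] the scalar one is, by [sdr_sdr_pt]. *)
Lemma sdr_lact_pt a b : ldiv a b <= sdr (a *> pt) (b *> pt).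
Proof. by rewrite sdrE pt_lact lact_homo // mul_ldiv. Qed.

Lemma sdl_lact_pt a b : rdiv b a <= sdl (b *> pt) (a *> pt).
Proof. by rewrite sdlE -lactA lact_homo // mul_rdiv. Qed.

Lemma sdr_sdr_pt x y : sdr x y <= ldiv (sdr pt x) (sdr pt y).
Proof.
by rewrite ldivE sdrE ractA (le_trans _ (ract_sdr x y)) // ract_homo // ract_sdr.
Qed.

Lemma sdl_sdr_pt x y : sdl y x <= rdiv (sdr pt y) (sdr pt x).
Proof.
rewrite -!sdl_pt rdivE sdlE lactA (le_trans _ (lact_sdl x y)) //.
by rewrite lact_homo // lact_sdl.
Qed.

(** The left side is the second coordinate of [e_S a ** e_M x]; its first joinand is absorbed
    because [pt <* sdr pt x <= x]. *)
Lemma lact_e_M a x : (a *> pt) <* sdr pt x `|` a *> x = a *> x.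
Proof. by apply: join_r; rewrite lractA lact_homo // ract_sdr. Qed.

Lemma ract_e_M a x : x <* a `|` sdr pt x *> (a *> pt) = x <* a.
Proof.
apply: join_l; rewrite pt_cyclic -lractA ract_homo // -sdl_pt.
exact: lact_sdl.
Qed.

Variable H : has_structural (nagata_ops B).

Lemma Nsigma_snd (p : Nsigma H) : (sval p).2 = (sval p).1 *> pt.
Proof. exact/esym/(congr1 snd (sK p)). Qed.

Lemma Ngamma_fst (p : Ngamma H) : (sval p).1 = sdr pt (sval p).2.
Proof. exact/esym/(congr1 fst (gK p)). Qed.

(** Closing by [sigma] or [gamma] does not change the coordinate read off, so only the absorption of
    the extra joinand or meetand remains. *)
Lemma counit_morph : @bimodule_morph (structural_bimodule H) B
  (fun p => (val p).1) (fun p => (val p).2).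
Proof.
split; first split; rewrite //=.
- by move=> p q /=; rewrite !Nsigma_snd; apply: meet_l; exact: sdr_lact_pt.
- by move=> p q /=; rewrite !Nsigma_snd; apply: meet_l; exact: sdl_lact_pt.
- by move=> p q; rewrite Nsigma_snd Ngamma_fst lact_e_M.
- by move=> q p; rewrite Nsigma_snd Ngamma_fst ract_e_M.
- by move=> q p; rewrite !Ngamma_fst; apply: meet_r; exact: sdl_sdr_pt.
- by move=> q p; rewrite !Ngamma_fst; apply: meet_r; exact: sdr_sdr_pt.
Qed.

Definition counit_hom : bimodule_hom (structural_bimodule H) B :=
  BimoduleHom counit_morph.

End Counit.

(** * The inverse of the counit, along an injective morphism into the Nagata product *)

Section Embedding.
Variables (B : bimodule) (N : nagataOps) (H : has_structural N).
Variables (j : nagata_hom N (nagata_ops B)) (j_inj : injective j).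
Variables (es : scal B -> N) (em : modl B -> N).
Hypotheses (esE : forall a, j (es a) = e_S a) (emE : forall x, j (em x) = e_M x).

(* With j the identity or the inclusion of the restricted product, this is    *)
(* the counit of either adjunction.                                           *)
Definition proj_hom : bimodule_hom (structural_bimodule H) B :=
  bimodule_comp (counit_hom (nagata_has_structural (nagataP B)))
    (structural_hom _ _ j).

(** Being fixed by [sigma] can be tested after the injective [j], and [e_S a] is fixed in the Nagata
    product. *)
Lemma range_es a : range (@sigma N) (es a).
Proof.
exists (es a) => //; apply: j_inj.
by rewrite (nm_sigma (nagata_homP j)) esE.
Qed.

Lemma range_em x : range (@gamma N) (em x).
Proof.
exists (em x) => //; apply: j_inj.
by rewrite (nm_gamma (nagata_homP j)) emE.
Qed.

Definition emb_s a : Nsigma H := inS H (range_es a).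
Definition emb_m x : Ngamma H := inG H (range_em x).

Lemma emb_sK : cancel emb_s (hscal proj_hom).
Proof. by move=> a; rewrite /= esE. Qed.

Lemma emb_mK : cancel emb_m (hmodl proj_hom).
Proof. by move=> x; rewrite /= emE. Qed.

(** An element of [Nsigma H] is fixed by [sigma], and [sigma q = e_S q.1] in the Nagata product, so
    the first coordinate of its image determines it. *)
Lemma proj_sK : cancel (hscal proj_hom) emb_s.
Proof.
move=> p; apply: val_inj; apply: j_inj; rewrite /= esE -[X in _ = j X]sK.
by rewrite (nm_sigma (nagata_homP j)).
Qed.

Lemma proj_mK : cancel (hmodl proj_hom) emb_m.
Proof.
move=> p; apply: val_inj; apply: j_inj; rewrite /= emE -[X in _ = j X]gK.
by rewrite (nm_gamma (nagata_homP j)).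
Qed.

Definition emb_hom : bimodule_hom B (structural_bimodule H) :=
  BimoduleHom (bimodule_morph_can proj_sK emb_sK proj_mK emb_mK).

Lemma emb_homK : bimodule_comp proj_hom emb_hom = bimodule_id B.
Proof. by apply: bimodule_hom_eq; [exact: emb_sK | exact: emb_mK]. Qed.

Lemma proj_homK : bimodule_comp emb_hom proj_hom = bimodule_id _.
Proof. by apply: bimodule_hom_eq; [exact: proj_sK | exact: proj_mK]. Qed.

End Embedding.

Lemma rnagata_val_morph (B : bimodule) :
  @nagata_morph (rnagata_ops B) (nagata_ops B) val.
Proof. by []. Qed.

Definition rnagata_incl (B : bimodule) : nagata_hom (rnagata_ops B) (nagata_ops B) :=
  NagataHom (rnagata_val_morph B).

(** * The two adjunctions *)

Definition nagata_adjunction : adjunction structural_functor nagata_functor.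
Proof.
refine (@Adjunction nagata_cat bimodule_cat structural_functor nagata_functor
  (fun N : nagataLattice => unit_hom (nlP N) (nagata_has_structural (nlP N)))
  (fun B => proj_hom (nagata_has_structural (nlP (nagata B))) (nagata_id _))
  _ _ _ _).
- move=> N N' f; apply: nagata_hom_eq => m; congr pair; apply: val_inj => /=.
    by rewrite (nm_sigma (nagata_homP f)).
  by rewrite (nm_gamma (nagata_homP f)).
- by move=> B B' g; apply: bimodule_hom_eq.
- move=> N; apply: bimodule_hom_eq => p; apply: val_inj.
    exact: sK.
  exact: gK.
- by move=> B; apply: nagata_hom_eq => -[a x].
Defined.

Definition rnagata_adjunction : adjunction rstructural_functor rnagata_functor.
Proof.
refine (@Adjunction rnagata_cat bimodule_cat rstructural_functor rnagata_functor
  (fun N : rnagataLattice => runit_hom (rnP N) (rnagata_has_structural (rnP N)))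
  (fun B => proj_hom (rnagata_has_structural (rnP (rnagata B))) (rnagata_incl B))
  _ _ _ _).
- move=> N N' f; apply: nagata_hom_eq => m; apply: val_inj.
  congr pair; apply: val_inj => /=.
    by rewrite (nm_sigma (nagata_homP f)).
  by rewrite (nm_gamma (nagata_homP f)).
- by move=> B B' g; apply: bimodule_hom_eq.
- move=> N; apply: bimodule_hom_eq => p; apply: val_inj.
    exact: sK.
  exact: gK.
- by move=> B; apply: nagata_hom_eq => -[[a x] p]; apply: val_inj.
Defined.

Theorem theoremB :
  (exists A : adjunction structural_functor nagata_functor,
    [/\ forall (N : nagataLattice) (m : N),
          let p := (unit_adj A N : nagata_hom N _) m in
          \val p.1 = sigma m /\ \val p.2 = gamma m,
        forall N : nagataLattice, injective (unit_adj A N : nagata_hom N _)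
      & forall B : bimodule,
          exists e : bimodule_hom B (structural_functor (nagata_functor B)),
            [/\ forall a : scal B, \val (hscal e a) = e_S a,
                forall x : modl B, \val (hmodl e x) = e_M x,
                bimodule_comp (counit_adj A B) e = bimodule_id B
              & bimodule_comp e (counit_adj A B) = bimodule_id _]])
  /\
  (exists A : adjunction rstructural_functor rnagata_functor,
    [/\ forall (N : rnagataLattice) (m : N),
          let p := \val ((unit_adj A N : nagata_hom N _) m) in
          \val p.1 = sigma m /\ \val p.2 = gamma m,
        forall N : rnagataLattice, injective (unit_adj A N : nagata_hom N _)
      & forall B : bimodule,
          exists e : bimodule_hom B (rstructural_functor (rnagata_functor B)),
            [/\ forall a : scal B, \val (\val (hscal e a)) = e_S a,
                forall x : modl B, \val (\val (hmodl e x)) = e_M x,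
                bimodule_comp (counit_adj A B) e = bimodule_id B
              & bimodule_comp e (counit_adj A B) = bimodule_id _]]).
Proof.
split; [exists nagata_adjunction | exists rnagata_adjunction]; split.
- by [].
- by move=> N; exact: unit_hom_inj.
- move=> B; pose j := nagata_id (nagata_ops B).
  have jI : injective j by [].
  have jS a : j (e_S a) = e_S a by [].
  have jM x : j (e_M x) = e_M x by [].
  exists (emb_hom (nagata_has_structural (nlP (nagata B))) jI jS jM).
  by split=> //; [exact: emb_homK | exact: proj_homK].
- by [].
- by move=> N; exact: runit_hom_inj.
- move=> B; pose j := rnagata_incl B.
  (* [sigma] ignores the second coordinate and [gamma] the first, so [pt] here and [rl1] below are
     mere fillers. *)
  pose es a : rnagata_ops B := exist _ (e_S a) (restricted_s (a, pt)).
  pose em x : rnagata_ops B := exist _ (e_M x) (restricted_g (rl1, x)).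
  have jS a : j (es a) = e_S a by [].
  have jM x : j (em x) = e_M x by [].
  have jI : injective j by exact: val_inj.
  exists (emb_hom (rnagata_has_structural (rnP (rnagata B))) jI jS jM).
  by split=> //; [exact: emb_homK | exact: proj_homK].
Qed.
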